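(* Let $k\ge 0$ be an integer, and for $\frac{p}{q}\in\mathbb{Q}\cap[0,1]$ let $m^{(k)}_{\frac{p}{q}}$ denote the $k$-Markov number indexed by $\frac{p}{q}$. Let $p,q$ be positive integers such that $1\le p<q$ and $\gcd(p,q)=1$. Then: (1) (Fixed Numerator) if $q<q'$ and $\gcd(p,q')=1$, then $m^{(k)}_{\frac{p}{q}}<m^{(k)}_{\frac{p}{q'}}$; (2) (Fixed Denominator) if $p<p'<q$ and $\gcd(p',q)=1$, then $m^{(k)}_{\frac{p}{q}}<m^{(k)}_{\frac{p'}{q}}$; (3) (Fixed Sum) if $0<i<p$ is such that $\gcd(p-i,q+i)=1$, then $m^{(k)}_{\frac{p}{q}}<m^{(k)}_{\frac{p-i}{q+i}}$. Here $q',p',i$ are integers.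
   Context: Fix an integer $k\ge 0$. A $k$-Markov triple is a triple of positive integers satisfying $x^2+y^2+z^2+k(xy+xz+yz)=(3+3k)xyz$; its entries are called $k$-Markov numbers. The $k$-Markov tree is the infinite rooted binary tree whose vertices are labeled by triples of positive integers, with root $(1,k+2,1)$, such that each vertex $(a,b,c)$ has left child $\left(b,\frac{b^2+kbc+c^2}{a},c\right)$ and right child $\left(a,\frac{a^2+kab+b^2}{c},b\right)$ (all these triples are $k$-Markov triples). The Farey tree is the infinite rooted binary tree whose vertices are labeled by triples from $\mathbb{Q}\cup\{\frac10\}$, with root $(\frac01,\frac11,\frac10)$, such that each vertex $(\frac{r}{s},\frac{p}{q},\frac{t}{u})$ has left child $(\frac{p}{q},\frac{p+t}{q+u},\frac{t}{u})$ and right child $(\frac{r}{s},\frac{r+p}{s+q},\frac{p}{q})$. Every positive rational number appears as the middle entry of exactly one vertex of the Farey tree. The two trees are identified by the canonical isomorphism of rooted binary trees (root to root, left child to left child, right child to right child). For $\frac{p}{q}\in\mathbb{Q}$ with $0<\frac pq<1$, $m^{(k)}_{\frac{p}{q}}$ is the middle entry of the vertex of the $k$-Markov tree corresponding to the unique vertex of the Farey tree with middle entry $\frac{p}{q}$; moreover $m^{(k)}_{\frac01}=1$ and $m^{(k)}_{\frac11}=k+2$. *)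

(* Defs.v *)
From mathcomp Require Import all_boot all_order all_algebra.
From mathcomp Require Import boolp classical_sets.
From mathcomp Require Import zify ring.

Set Implicit Arguments.
Unset Strict Implicit.
Unset Printing Implicit Defensive.

Import Order.TTheory GRing.Theory Num.Theory.

(* A vertex of the infinite rooted binary tree is given by its address, the
   list of moves leading to it from the root.  The canonical isomorphism between
   two such trees is then the identity on addresses.  The move true goes to the
   left child, false to the right child. *)
Definition address := seq bool.

(* The division is exact and labels are positive: see kmarkov_tree_triple and
   kmarkov_division_exact below. *)
Definition kmarkov_child (k : nat) (v : nat * nat * nat) (left : bool) :
    nat * nat * nat :=
  let: (a, b, c) := v in
  if left then (b, (b ^ 2 + k * b * c + c ^ 2) %/ a, c)
  else (a, (a ^ 2 + k * a * b + b ^ 2) %/ c, b).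

Definition kmarkov_tree (k : nat) (w : address) : nat * nat * nat :=
  foldl (kmarkov_child k) (1, k.+2, 1) w.

(* A pair (a, b) is the fraction a/b; (1, 0) is 1/0.  All the fractions in the
   tree are in lowest terms, so that no reduction is needed in the mediant. *)
Definition fraction := (nat * nat)%type.

Definition mediant (f g : fraction) : fraction := (f.1 + g.1, f.2 + g.2).

Definition farey_child (v : fraction * fraction * fraction) (left : bool) :
    fraction * fraction * fraction :=
  let: (f, g, h) := v in
  if left then (g, mediant g h, h) else (f, mediant f g, g).

Definition farey_tree (w : address) : fraction * fraction * fraction :=
  foldl farey_child ((0, 1), (1, 1), (1, 0)) w.

Definition middle (T : Type) (v : T * T * T) : T := v.1.2.

(* Only used on fractions with a nonzero denominator, see farey_middle_gt0. *)
Definition rat_of_fraction (f : fraction) : rat := (f.1%:Q / f.2%:Q)%R.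

(* Meaningful for 0 < x, where the address exists and is unique, see
   farey_address_exists and farey_address_unique. *)
Definition farey_address (x : rat) : address :=
  xget [::] [set w | rat_of_fraction (middle (farey_tree w)) = x]%classic.

(* 0/1 is not the middle entry of any vertex. *)
Definition kmarkov_number (k : nat) (x : rat) : nat :=
  if x == 0%R then 1 else middle (kmarkov_tree k (farey_address x)).

Definition kmarkov_triple (k : nat) (v : nat * nat * nat) : Prop :=
  let: (x, y, z) := v in
  [/\ 0 < x, 0 < y, 0 < z &
      x ^ 2 + y ^ 2 + z ^ 2 + k * (x * y + x * z + y * z)
        = (3 + 3 * k) * x * y * z].

Lemma kmarkov_vieta k x y z : kmarkov_triple k (x, y, z) ->
  x %| y ^ 2 + k * y * z + z ^ 2 /\
  kmarkov_triple k ((y ^ 2 + k * y * z + z ^ 2) %/ x, y, z).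
Proof.
move=> [x0 y0 z0 e].
have dv : x %| y ^ 2 + k * y * z + z ^ 2.
  have -> : y ^ 2 + k * y * z + z ^ 2
          = x * ((3 + 3 * k) * y * z) - x * (x + k * y + k * z) by nia.
  by rewrite dvdn_sub // dvdn_mulr.
split=> //; case/dvdnP: (dv) => t et; rewrite et mulnK //.
have t0 : 0 < t by nia.
have s : x + t + k * (y + z) = (3 + 3 * k) * y * z.
  by apply/eqP; rewrite -(eqn_pmul2l x0); apply/eqP; nia.
split=> //; have := congr1 (muln t) s; nia.
Qed.

Lemma kmarkov_tripleC12 k x y z :
  kmarkov_triple k (x, y, z) -> kmarkov_triple k (y, x, z).
Proof. by move=> [*]; split=> //; nia. Qed.

Lemma kmarkov_tripleC23 k x y z :
  kmarkov_triple k (x, y, z) -> kmarkov_triple k (x, z, y).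
Proof. by move=> [*]; split=> //; nia. Qed.

Lemma kmarkov_child_triple k v d :
  kmarkov_triple k v -> kmarkov_triple k (kmarkov_child k v d).
Proof.
case: v => [[a b] c] h; case: d => /=.
  by have [_ /kmarkov_tripleC12] := kmarkov_vieta h.
have [_] := kmarkov_vieta (kmarkov_tripleC12 (kmarkov_tripleC23 h)).
by move/kmarkov_tripleC12.
Qed.

Lemma kmarkov_tree_triple k w : kmarkov_triple k (kmarkov_tree k w).
Proof.
rewrite /kmarkov_tree.
have: kmarkov_triple k (1, k.+2, 1) by split=> //; nia.
elim: w (1, k.+2, 1) => //= d w IH v /(kmarkov_child_triple d); exact: IH.
Qed.

Lemma kmarkov_division_exact k w :
  let: (a, b, c) := kmarkov_tree k w in
  a %| b ^ 2 + k * b * c + c ^ 2 /\ c %| a ^ 2 + k * a * b + b ^ 2.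
Proof.
have := kmarkov_tree_triple k w; case: (kmarkov_tree k w) => [[a b] c] h.
have [? _] := kmarkov_vieta h.
by have [? _] := kmarkov_vieta (kmarkov_tripleC12 (kmarkov_tripleC23 h)).
Qed.

(* The middle entry at address w below a vertex (f, f + h, h) is the combination
   of f and h with the coefficients farey_coef w. *)
Fixpoint farey_coef (w : address) : nat * nat :=
  match w with
  | [::] => (1, 1)
  | d :: w' => let: (a, b) := farey_coef w' in
               if d then (a, a + b) else (a + b, b)
  end.

Lemma farey_coefP w : let: (a, b) := farey_coef w in
  [/\ 0 < a, 0 < b & coprime a b].
Proof.
elim: w => [|d w] //=; case: (farey_coef w) => a b [a0 b0 co].
case: d; split=> //; rewrite ?addn_gt0 ?a0 ?b0 //.
  by rewrite /coprime gcdnDl.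
by rewrite coprime_sym /coprime gcdnDr gcdnC.
Qed.

Lemma farey_middleE w : middle (farey_tree w) = ((farey_coef w).2, (farey_coef w).1).
Proof.
have H f h : middle (foldl farey_child (f, mediant f h, h) w) =
    let: (a, b) := farey_coef w in (a * f.1 + b * h.1, a * f.2 + b * h.2).
  elim: w f h => [|d w IH] f h /=; first by rewrite !mul1n.
  by case: d; rewrite IH; case: (farey_coef w) => a b /=; congr (_, _); ring.
rewrite /farey_tree (H (0, 1) (1, 0)).
by case: (farey_coef w) => a b /=; rewrite !muln0 !muln1 addn0.
Qed.

Lemma farey_coef_inj : injective farey_coef.
Proof.
elim=> [|d w IH] [|d' w'] //=.
- by have := farey_coefP w'; case: (farey_coef w') d' => a b [] [? ? _] [*]; lia.
- by have := farey_coefP w; case: (farey_coef w) d => a b [] [? ? _] [*]; lia.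
have := farey_coefP w; have := farey_coefP w'; move: (IH w').
case: (farey_coef w) (farey_coef w') => a b [a' b'] H [? ? _] [? ? _] e.
have ed : d = d' by case: d d' e => [] [] // [*]; lia.
rewrite -ed in e *; congr (_ :: _); apply: H.
by case: d e {ed} => [] [*]; congr (_, _); lia.
Qed.

Lemma farey_coef_surj a b : 0 < a -> 0 < b -> coprime a b ->
  exists w, farey_coef w = (a, b).
Proof.
have [n] := ubnP (a + b); elim: n a b => // n IH a b lt_n a0 b0 co.
case: (ltngtP a b) => [lt_ab|lt_ba|e].
- have [w ew] : exists w, farey_coef w = (a, b - a).
    apply: IH => //; try lia.
    by rewrite /coprime -gcdnDl subnKC // ltnW.
  by exists (true :: w) => /=; rewrite ew subnKC // ltnW.
- have [w ew] : exists w, farey_coef w = (a - b, b).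
    apply: IH => //; try lia.
    by rewrite coprime_sym /coprime -gcdnDr subnK 1?gcdnC // ltnW.
  by exists (false :: w) => /=; rewrite ew subnK // ltnW.
- by exists [::]; move: co; rewrite -e /coprime gcdnn => /eqP ->.
Qed.

Lemma farey_middle_gt0 w : 0 < (middle (farey_tree w)).1 /\
  0 < (middle (farey_tree w)).2.
Proof.
by rewrite farey_middleE; have := farey_coefP w; case: (farey_coef w) => a b [].
Qed.

Lemma farey_middle_coprime w :
  coprime (middle (farey_tree w)).1 (middle (farey_tree w)).2.
Proof.
rewrite farey_middleE coprime_sym.
by have := farey_coefP w; case: (farey_coef w) => a b [].
Qed.

Lemma rat_of_fraction_inj (f g : fraction) : 0 < f.2 -> 0 < g.2 ->
  coprime f.1 f.2 -> coprime g.1 g.2 ->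
  rat_of_fraction f = rat_of_fraction g -> f = g.
Proof.
case: f g => [a b] [c d] /= b0 d0 cab ccd /eqP.
rewrite /rat_of_fraction /= eqr_div ?intr_eq0 -?lt0n //; try lia.
rewrite -!intrM eqr_int -!PoszM eqz_nat => /eqP e.
have eb : b = d.
  apply/eqP; rewrite eqn_dvd; apply/andP; split.
    by rewrite -(@Gauss_dvdr b a) 1?coprime_sym // e dvdn_mull.
  by rewrite -(@Gauss_dvdr d c) 1?coprime_sym // -e dvdn_mull.
by congr (_, _) => //; apply/eqP; rewrite -(eqn_pmul2r d0) e eb.
Qed.

Lemma farey_address_unique w w' :
  rat_of_fraction (middle (farey_tree w)) =
  rat_of_fraction (middle (farey_tree w')) -> w = w'.
Proof.
move/rat_of_fraction_inj => H; apply: farey_coef_inj.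
have := H (farey_middle_gt0 w).2 (farey_middle_gt0 w').2
  (farey_middle_coprime w) (farey_middle_coprime w').
by rewrite !farey_middleE; case: farey_coef => a b; case: farey_coef => c d [-> ->].
Qed.

Lemma farey_address_exists (x : rat) : (0 < x)%R ->
  exists w, rat_of_fraction (middle (farey_tree w)) = x.
Proof.
move=> x0; have nx : (0 < numq x)%R by rewrite numq_gt0.
have [|||w ew] := @farey_coef_surj `|denq x| `|numq x|; rewrite ?absz_gt0 ?denq_neq0 //.
- by rewrite gt_eqF.
- by rewrite coprime_sym coprime_num_den.
exists w; rewrite farey_middleE ew /rat_of_fraction /=.
by rewrite !gez0_abs ?ltW // divq_num_den.
Qed.

Lemma farey_addressK w :
  farey_address (rat_of_fraction (middle (farey_tree w))) = w.
Proof.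
rewrite /farey_address; case: xgetP => [w' _ /farey_address_unique //|H].
by have := H w erefl.
Qed.

Lemma kmarkov_numberE k w :
  kmarkov_number k (rat_of_fraction (middle (farey_tree w)))
    = middle (kmarkov_tree k w).
Proof.
rewrite /kmarkov_number farey_addressK ifF //; apply/negbTE.
have [a0 b0] := farey_middle_gt0 w.
by rewrite /rat_of_fraction mulf_neq0 ?invr_eq0 ?intr_eq0 -?lt0n //; lia.
Qed.

Lemma kmarkov_number0 k : kmarkov_number k (0%:Q / 1%:Q)%R = 1.
Proof. by []. Qed.

Lemma kmarkov_number1 k : kmarkov_number k (1%:Q / 1%:Q)%R = k.+2.
Proof. exact: (kmarkov_numberE k [::]). Qed.

(* Main.v *)
Require Import Defs.
From mathcomp Require Import all_boot all_order all_algebra.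
From mathcomp Require Import reals sequences exp Rstruct.
From mathcomp Require Import zify ring lra.
Import Order.TTheory GRing.Theory Num.Theory.

(* To a fraction v attach the trace X = (3 + 3k) m_v - k and the length
   L(v) = ln u, where u + 1/u = X and 1 <= u.  The lengths behave like a strictly
   convex norm on the primitive vectors v = (numerator, denominator): each v has
   a linear functional g with g(v) = L(v) and g(y) < L(y) for every other y.
   For the Farey neighbors y of v this follows from the linear recurrence of the
   traces along w, w + v, w + 2v, ..., solved explicitly; the other y are reached
   by induction on the determinant of (v, y), comparing g with the functional of
   a fraction q between v and y that is a neighbor of v.
   Let v = (p, q) with p < q and g = (g1, g2).  Evaluating g at (q, p), which has
   the same length as v, gives g1 < g2; hence g2 > 0 because g(v) > 0.  Since
   g2 <= L(0/1) and q L(0/1) <= L(v), also g1 >= 0.  So g does not decrease in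
   any of the three directions, and L(v) = g(v) <= g(v') < L(v'). *)

(** * Labels of fractions and their Vieta relations *)

(* Extends the indexing to 1/0, whose label in the tree is 1. *)
Definition label (k : nat) (f : fraction) : nat :=
  if f.2 == 0 then 1 else kmarkov_number k (rat_of_fraction f).

(* f < h are Farey neighbors: the determinant of h and f is 1. *)
Definition neighbor (f h : fraction) : Prop := f.2 * h.1 = (f.1 * h.2).+1.

Lemma label_middle k w : label k (middle (farey_tree w)) = middle (kmarkov_tree k w).
Proof.
by rewrite /label kmarkov_numberE eqn0Ngt (farey_middle_gt0 w).2.
Qed.

Lemma farey_treeE w :
  exists f h, farey_tree w = (f, mediant f h, h) /\ neighbor f h.
Proof.
elim/last_ind: w => [|w d [f [h [e n]]]]; first by exists (0, 1), (1, 0).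
rewrite /farey_tree foldl_rcons -/(farey_tree w) e.
case: f h n {e} => [a b] [c e]; rewrite /neighbor /mediant /= => n.
case: d; [exists (a + c, b + e), (c, e) | exists (a, b), (a + c, b + e)].
  by split=> //; rewrite /neighbor /=; lia.
by split=> //; rewrite /neighbor /=; lia.
Qed.

(** A child shares two entries with its parent, and [label_middle] covers its new middle entry. So a
    label depends only on the fraction, wherever it occurs in the tree. *)
Lemma label_farey_tree k w f g h : farey_tree w = (f, g, h) ->
  kmarkov_tree k w = (label k f, label k g, label k h).
Proof.
elim/last_ind: w f g h => [|w d IH] f g h.
  case=> <- <- <-; rewrite -[(1, 1)]/(middle (farey_tree [::])) label_middle.
  by congr (_, _, _).
have [f0 [h0 [e _]]] := farey_treeE w.
move=> e'; have em := label_middle k (rcons w d); move: em; rewrite e' /middle /=.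
move: e'; rewrite /farey_tree /kmarkov_tree !foldl_rcons.
rewrite -/(farey_tree w) -/(kmarkov_tree k w) e (IH _ _ _ e) /=.
by case: d => -[<- <- <-] -> /=.
Qed.

(** Euclidean descent: unless the pair is 0/1, 1/0, one of the two fractions dominates the other in
    both entries, and subtracting the smaller one from it undoes the last move. *)
Lemma farey_tree_surj f h : neighbor f h ->
  exists w, farey_tree w = (f, mediant f h, h).
Proof.
case: f h => [a b] [c d]; rewrite /neighbor /=.
have [n] := ubnP (a + b + c + d); elim: n a b c d => // n IH a b c d lt_n det.
have [[a0 d0]|pos] : (a = 0 /\ d = 0) \/ (0 < a + d) by lia.
  exists [::]; move: det; rewrite a0 d0 mul0n => /eqP.
  by rewrite muln_eq1 => /andP[/eqP-> /eqP->].
have [[le1 le2]|[le1 le2]] : (c <= a /\ d <= b) \/ (a <= c /\ b <= d).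
- case: (leqP c a) => h1; case: (leqP d b) => h2; try by [left|right; split; lia].
    have : b.+1 * a <= d * a by rewrite leq_mul2r h2 orbT.
    have : b * c <= b * a by rewrite leq_mul2l h1 orbT.
    lia.
  case: (ltnP d b) => h3; last by right; split; lia.
  have : d.+1 * a.+1 <= b * c by rewrite leq_mul.
  lia.
- have [||w e] := IH (a - c) (b - d) c d; try nia.
  exists (rcons w true); rewrite /farey_tree foldl_rcons -/(farey_tree w) e.
  by rewrite /mediant /= !subnK.
have [||w e] := IH a b (c - a) (d - b); try nia.
exists (rcons w false); rewrite /farey_tree foldl_rcons -/(farey_tree w) e.
by rewrite /mediant /= !subnKC.
Qed.

Lemma label_triple k f h : neighbor f h ->
  kmarkov_triple k (label k f, label k (mediant f h), label k h).
Proof.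
case/farey_tree_surj=> w /(label_farey_tree k) <-; exact: kmarkov_tree_triple.
Qed.

(** [x] and [x'] are the two roots of the equation read as a quadratic in its first unknown: their
    product is given, their sum follows. The sum form is free of division. *)
Lemma vieta_sum k x y z x' : kmarkov_triple k (x, y, z) ->
  x * x' = y ^ 2 + k * y * z + z ^ 2 ->
  x + x' + k * (y + z) = (3 + 3 * k) * y * z.
Proof.
move=> [x0 _ _ e] e'; apply/eqP; rewrite -(eqn_pmul2l x0); apply/eqP; nia.
Qed.

Lemma label_vieta_left k f h : neighbor f h ->
  label k f + label k (mediant (mediant f h) h)
    + k * (label k (mediant f h) + label k h)
  = (3 + 3 * k) * label k (mediant f h) * label k h.
Proof.
move=> n; apply: (vieta_sum _ _ _ _ _ (label_triple k f h n)).
have [w e] := farey_tree_surj _ _ n.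
have := label_farey_tree k w _ _ _ e => em.
have := label_middle k (rcons w true); rewrite /farey_tree /kmarkov_tree.
rewrite !foldl_rcons -/(farey_tree w) -/(kmarkov_tree k w) e em /middle /= => ->.
by have := kmarkov_division_exact k w; rewrite em => -[dv _]; rewrite mulnC divnK.
Qed.

Lemma label_vieta_right k f h : neighbor f h ->
  label k h + label k (mediant f (mediant f h))
    + k * (label k f + label k (mediant f h))
  = (3 + 3 * k) * label k f * label k (mediant f h).
Proof.
move=> n; have := label_triple k f h n.
move=> /kmarkov_tripleC23 /kmarkov_tripleC12 t; apply: (vieta_sum _ _ _ _ _ t).
have [w e] := farey_tree_surj _ _ n.
have := label_farey_tree k w _ _ _ e => em.
have := label_middle k (rcons w false); rewrite /farey_tree /kmarkov_tree.
rewrite !foldl_rcons -/(farey_tree w) -/(kmarkov_tree k w) e em /middle /= => ->.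
by have := kmarkov_division_exact k w; rewrite em => -[_ dv]; rewrite mulnC divnK.
Qed.

(** * Symmetry of the labels under inversion of fractions *)

Definition swap (f : fraction) : fraction := (f.2, f.1).

(** Both roots are unchanged by reversing the triple, with fractions inverted, and this reversal
    exchanges left and right moves. *)
Lemma farey_tree_negb k w f g h : farey_tree w = (f, g, h) ->
  farey_tree (map negb w) = (swap h, swap g, swap f) /\
  forall a b c, kmarkov_tree k w = (a, b, c) ->
    kmarkov_tree k (map negb w) = (c, b, a).
Proof.
elim/last_ind: w f g h => [|w d IH] f g h.
  by case=> <- <- <-; split=> // a b c [<- <- <-].
have [f0 [h0 [e _]]] := farey_treeE w.
have [ef em] := IH _ _ _ e.
rewrite map_rcons /farey_tree /kmarkov_tree !foldl_rcons.
rewrite -/(farey_tree _) -/(farey_tree _) -/(kmarkov_tree k _) -/(kmarkov_tree k _).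
rewrite e ef; case: (kmarkov_tree k w) em => [[x y] z] /(_ _ _ _ erefl) ->.
case: d => /= -[<- <- <-]; split; rewrite ?/mediant ?/swap /=.
- by congr (_, _, _); congr (_, _); rewrite addnC.
- by move=> a b c [<- <- <-]; congr (_, _ %/ _, _); lia.
- by congr (_, _, _); congr (_, _); rewrite addnC.
- by move=> a b c [<- <- <-]; congr (_, _ %/ _, _); lia.
Qed.

Lemma coprime_middle p q : 0 < p -> 0 < q -> coprime p q ->
  exists w, middle (farey_tree w) = (p, q).
Proof.
move=> p0 q0 co; have [|||w e] := @farey_coef_surj q p => //.
  by rewrite coprime_sym.
by exists w; rewrite farey_middleE e.
Qed.

Lemma label_swap k f : 0 < f.1 -> 0 < f.2 -> coprime f.1 f.2 ->
  label k (swap f) = label k f.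
Proof.
case: f => p q p0 q0 co; have [w e] := coprime_middle _ _ p0 q0 co.
rewrite -e label_middle.
have [f0 [h0 [e' _]]] := farey_treeE w.
have [ef em] := farey_tree_negb k w _ _ _ e'.
have -> : swap (middle (farey_tree w)) = middle (farey_tree (map negb w)).
  by rewrite ef e'.
rewrite label_middle; case: (kmarkov_tree k w) em => [[a b] c] /(_ _ _ _ erefl) ->.
by [].
Qed.

(** * Farey neighbors and intermediate fractions *)

Lemma coprime_neighbor f h : neighbor f h -> coprime f.1 f.2 /\ coprime h.1 h.2.
Proof.
rewrite /neighbor => n; split; rewrite /coprime -dvdn1.
  rewrite -(@dvdn_addr (f.1 * h.2)); last by rewrite dvdn_mulr ?dvdn_gcdl.
  by rewrite addn1 -n dvdn_mulr ?dvdn_gcdr.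
rewrite -(@dvdn_addr (f.1 * h.2)); last by rewrite dvdn_mull ?dvdn_gcdr.
by rewrite addn1 -n dvdn_mull ?dvdn_gcdl.
Qed.

Lemma neighbor_mediant f h : neighbor f h ->
  neighbor f (mediant f h) /\ neighbor (mediant f h) h.
Proof. by rewrite /neighbor /=; split; lia. Qed.

Lemma neighbor_exists x : 0 < x.2 -> coprime x.1 x.2 -> exists h, neighbor x h.
Proof.
case: x => [[|a] b] /= b0 co.
  by exists (1, 0); move: co; rewrite /coprime gcd0n /neighbor /= => /eqP ->.
have [w] := coprime_middle a.+1 b erefl b0 co.
have [f [h [-> n]]] := farey_treeE w; rewrite /middle /= => <-.
by exists h; case: (neighbor_mediant _ _ n).
Qed.

Definition shift (u v : fraction) (n : nat) : fraction :=
  (u.1 + n * v.1, u.2 + n * v.2).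

Lemma neighbor_of_mediantP f h u : neighbor f h ->
  (neighbor (mediant f h) u -> exists n, u = shift h (mediant f h) n) /\
  (neighbor u (mediant f h) -> exists n, u = shift f (mediant f h) n).
Proof.
case: f h u => [f1 f2] [h1 h2] [u1 u2]; rewrite /neighbor /shift /= => det.
have f20 : 0 < f2 by case: f2 det.
have h10 : 0 < h1 by case: h1 det; rewrite ?muln0.
have dz : (f2%:Z * h1%:Z - f1%:Z * h2%:Z = 1)%R by lia.
split=> n.
- have nz : ((f2%:Z + h2%:Z) * u1%:Z - (f1%:Z + h1%:Z) * u2%:Z = 1)%R by lia.
  (* With v = f + h, Cramer's rule gives u = m v - f = h + (m - 1) v; nonnegative entries force 0 <
     m. *)
  pose m := (f2%:Z * u1%:Z - f1%:Z * u2%:Z)%R.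
  have e1 : (u1%:Z = m * (f1%:Z + h1%:Z) - f1%:Z)%R.
    by rewrite -[X in _ = (_ - X)%R]mulr1 -nz -[LHS]mulr1 -dz /m; ring.
  have e2 : (u2%:Z = m * (f2%:Z + h2%:Z) - f2%:Z)%R.
    by rewrite -[X in _ = (_ - X)%R]mulr1 -nz -[LHS]mulr1 -dz /m; ring.
  move: m e1 e2 => m e1 e2; have m0 : (0 < m)%R by nia.
  by exists `|(m - 1)%R|%N; congr (_, _); nia.
have nz : (u2%:Z * (f1%:Z + h1%:Z) - u1%:Z * (f2%:Z + h2%:Z) = 1)%R by lia.
pose m := (u2%:Z * h1%:Z - u1%:Z * h2%:Z)%R.
have e1 : (u1%:Z = m * (f1%:Z + h1%:Z) - h1%:Z)%R.
  by rewrite -[X in _ = (_ - X)%R]mulr1 -nz -[LHS]mulr1 -dz /m; ring.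
have e2 : (u2%:Z = m * (f2%:Z + h2%:Z) - h2%:Z)%R.
  by rewrite -[X in _ = (_ - X)%R]mulr1 -nz -[LHS]mulr1 -dz /m; ring.
move: m e1 e2 => m e1 e2; have m0 : (0 < m)%R by nia.
by exists `|(m - 1)%R|%N; congr (_, _); nia.
Qed.

Lemma neighbor_shift f h n : neighbor f h ->
  neighbor f (shift h f n) /\ neighbor (shift f h n) h.
Proof. by rewrite /neighbor /=; split; nia. Qed.

(* d and e are the determinants of (x, y) and (q, y). *)
Lemma fraction_between x y : coprime x.1 x.2 -> coprime y.1 y.2 ->
  x.1 * y.2 + 1 < x.2 * y.1 ->
  exists q d e,
    [/\ 0 < e < d, x.2 * y.1 = x.1 * y.2 + d & q.2 * y.1 = q.1 * y.2 + e] /\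
    [/\ neighbor x q, d * q.1 = e * x.1 + y.1 & d * q.2 = e * x.2 + y.2].
Proof.
move=> cx cy det; have x20 : 0 < x.2 by case: x.2 det.
have [h n] := neighbor_exists _ x20 cx.
case: x y h => [x1 x2] [y1 y2] [h1 h2] /= in cx cy det x20 n *.
rewrite /neighbor /= in n.
pose d := x2 * y1 - x1 * y2.
have ed : (d%:Z = x2%:Z * y1%:Z - x1%:Z * y2%:Z)%R by rewrite /d; lia.
have en : (x2%:Z * h1%:Z = x1%:Z * h2%:Z + 1)%R by lia.
have xyd : x2 * y1 = x1 * y2 + d by rewrite /d; lia.
have d2 : 1 < d by rewrite /d; lia.
(* As [x] and [h] have determinant 1, y = i x + d h. *)
pose i := (y2%:Z * h1%:Z - y1%:Z * h2%:Z)%R.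
have ey1 : (y1%:Z = i * x1%:Z + d%:Z * h1%:Z)%R.
  have -> : (i * x1%:Z + d%:Z * h1%:Z
    = y1%:Z * (x2%:Z * h1%:Z - x1%:Z * h2%:Z))%R by rewrite /i ed; ring.
  by rewrite en; ring.
have ey2 : (y2%:Z = i * x2%:Z + d%:Z * h2%:Z)%R.
  have -> : (i * x2%:Z + d%:Z * h2%:Z
    = y2%:Z * (x2%:Z * h1%:Z - x1%:Z * h2%:Z))%R by rewrite /i ed; ring.
  by rewrite en; ring.
have r0 : (0 <= (i %% d%:Z)%Z)%R by rewrite modz_ge0 //; lia.
have rd : ((i %% d%:Z)%Z < d%:Z)%R by rewrite ltz_pmod //; lia.
have ei := divz_eq i (Posz d).
move: (i %/ d%:Z)%Z (i %% d%:Z)%Z ei r0 rd => j r ei r0 rd.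
(* Otherwise [d], which exceeds 1, would divide both entries of y. *)
have rn0 : r != 0%R.
  apply/eqP => er; rewrite er addr0 in ei.
  have : (d %| gcdn y1 y2)%N.
    have dvd (z t : int) : (d %| (i * z + d%:Z * t)%R)%Z.
      by apply/dvdzP; exists (j * z + t)%R; rewrite ei; ring.
    by rewrite dvdn_gcd; apply/andP; split;
      [have := dvd x1 h1; rewrite -ey1 | have := dvd x2 h2; rewrite -ey2].
  by rewrite (eqP cy) dvdn1; lia.
(* Rounding i / d up to j + 1 gives q = h + (j + 1) x, so that d q = e x + y with e = d - r. *)
pose q1 := (h1%:Z + (j + 1) * x1%:Z)%R; pose q2 := (h2%:Z + (j + 1) * x2%:Z)%R.
pose e := `|(d%:Z - r)%R|%N.
have ee : (e%:Z = d%:Z - r)%R by rewrite /e; lia.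
have eq1 : (d%:Z * q1 = e%:Z * x1%:Z + y1%:Z)%R by rewrite ey1 ei ee /q1; ring.
have eq2 : (d%:Z * q2 = e%:Z * x2%:Z + y2%:Z)%R by rewrite ey2 ei ee /q2; ring.
have d0 : (0 < d%:Z)%R by lia.
have q10 : (0 <= q1)%R by rewrite -(pmulr_rge0 _ d0) eq1 addr_ge0 ?mulr_ge0.
have q20 : (0 <= q2)%R by rewrite -(pmulr_rge0 _ d0) eq2 addr_ge0 ?mulr_ge0.
have dq : (q2 * y1%:Z = q1 * y2%:Z + e%:Z)%R.
  rewrite ey1 ey2 ei ee /q1 /q2.
  have -> : (d%:Z - r = (d%:Z - r) * (x2%:Z * h1%:Z - x1%:Z * h2%:Z))%R.
    by rewrite en; ring.
  ring.
have nq : (x2%:Z * q1 = x1%:Z * q2 + 1)%R.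
  rewrite /q1 /q2 mulrDr en; ring.
exists (`|q1|%N, `|q2|%N), d, e; rewrite /neighbor /=.
clearbody d e q1 q2.
by split; split; lia.
Qed.

(** * The length of a trace and the solution of the recurrence *)

Section TraceLength.
Variable R : realType.
Local Open Scope ring_scope.
Implicit Types t x y : R.

(** The larger eigenvalue of a matrix of determinant 1 and trace [x], for 2 <= x. *)
Definition eigenvalue_of_trace x : R := (x + Num.sqrt (x ^+ 2 - 4)) / 2.

Definition trace_length x : R := ln (eigenvalue_of_trace x).

Lemma eigenvalue_ge1 x : 2 <= x -> 1 <= eigenvalue_of_trace x.
Proof.
move=> x2; rewrite /eigenvalue_of_trace.
have := sqrtr_ge0 (x ^+ 2 - 4); lra.
Qed.

Lemma eigenvalue_trace x : 2 <= x ->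
  eigenvalue_of_trace x + (eigenvalue_of_trace x)^-1 = x.
Proof.
move=> x2; have := eigenvalue_ge1 _ x2; rewrite /eigenvalue_of_trace.
set s := Num.sqrt _ => u1.
have es : s ^+ 2 = x ^+ 2 - 4 by rewrite sqr_sqrtr; nra.
have e : x + s != 0 by apply/eqP; lra.
apply/eqP; rewrite -subr_eq0; apply/eqP.
have -> : (x + s) / 2 + ((x + s) / 2)^-1 - x = (s ^+ 2 - (x ^+ 2 - 4)) / (2 * (x + s)).
  by field; rewrite e.
by rewrite es subrr mul0r.
Qed.

Lemma expR_trace_length x : 2 <= x -> expR (trace_length x) = eigenvalue_of_trace x.
Proof.
by move=> x2; rewrite lnK // posrE (lt_le_trans ltr01) ?eigenvalue_ge1.
Qed.

Lemma trace_length_le x y : 2 <= x -> x <= y -> trace_length x <= trace_length y.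
Proof.
move=> x2 xy; rewrite -ler_expR !expR_trace_length //; last exact: le_trans xy.
have : Num.sqrt (x ^+ 2 - 4) <= Num.sqrt (y ^+ 2 - 4) by rewrite ler_sqrt; nra.
rewrite /eigenvalue_of_trace; lra.
Qed.

Lemma trace_length_gt0 x : 2 < x -> 0 < trace_length x.
Proof.
move=> x2; apply: ln_gt0; rewrite /eigenvalue_of_trace.
have := sqrtr_ge0 (x ^+ 2 - 4); lra.
Qed.

(** The function t + 1/t is nondecreasing for t >= 1, so t cannot reach the eigenvalue of [x]. *)
Lemma ln_lt_trace_length t x : 0 < t -> 2 <= x -> t + t^-1 < x ->
  ln t < trace_length x.
Proof.
move=> t0 x2 tx; rewrite -ltr_expR expR_trace_length // lnK ?posrE //.
have u1 := eigenvalue_ge1 _ x2; rewrite -(eigenvalue_trace _ x2) in tx.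
move: (eigenvalue_of_trace x) u1 tx => u u1 tx.
rewrite ltNge; apply/negP => ut; move: tx; apply/negP; rewrite -leNgt.
have -> : t + t^-1 = u + u^-1 + (t - u) * (1 - (t * u)^-1).
  by field; apply/andP; split; apply/eqP; lra.
by rewrite lerDl mulr_ge0 ?subr_ge0 // invf_le1; nra.
Qed.

(* With u + 1/u = x the recurrences give y n = c' + a u^n + b / u^n and
   z n = c' + a / u^(n+1) + b u^(n+1) for c' = c / (x - 2), and the last
   inequality gives 1 < a b, so that s = ln a works. *)
Lemma support_of_recurrence x c (y z : nat -> R) :
  2 < x -> 0 <= c -> c < (x - 2) * y 0%N ->
  (forall n, 2 <= y n) -> (forall n, 2 <= z n) ->
  (forall n, y n.+2 + y n = x * y n.+1 - c) ->
  (forall n, z n.+2 + z n = x * z n.+1 - c) ->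
  y 1%N + z 0%N = x * y 0%N - c -> z 1%N + y 0%N = x * z 0%N - c ->
  x ^+ 2 + y 0%N ^+ 2 + z 0%N ^+ 2 + c * (x + y 0%N + z 0%N)
    <= x * y 0%N * z 0%N ->
  exists s, forall n,
    s + n%:R * trace_length x < trace_length (y n) /\
    n.+1%:R * trace_length x - s < trace_length (z n).
Proof.
move=> x2 c0 cy y2 z2 ry rz ey ez tri.
have x2' : 2 <= x by exact: ltW.
have el := expR_trace_length _ x2'.
have eu := eigenvalue_trace _ x2'.
have u1 : 1 < expR (trace_length x) by rewrite expR_gt1 trace_length_gt0.
rewrite -el in eu; move: eu u1; set l := trace_length x; set u := expR l => eu u1.
have u0 : 0 < u by lra.
have un0 : u != 0 by rewrite gt_eqF.
pose w := u - u^-1.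
have w0 : 0 < w by rewrite subr_gt0 (lt_trans _ u1) // invf_lt1.
(* The constant solution of the recurrence. *)
pose xs := c / (x - 2).
have exs : xs * (x - 2) = c by rewrite divfK // gt_eqF // subr_gt0.
have xs0 : 0 <= xs by rewrite divr_ge0 // subr_ge0.
(* [a] and [b] solve y 0 = xs + a + b and z 0 = xs + a / u + b u: [z] continues [y] to negative
   indices, z 0 standing at index -1. *)
pose a := (u * (y 0%N - xs) - (z 0%N - xs)) / w.
pose b := ((z 0%N - xs) - (y 0%N - xs) / u) / w.
have aw : a * w = u * (y 0%N - xs) - (z 0%N - xs) by rewrite divfK // gt_eqF.
have bw : b * w = (z 0%N - xs) - (y 0%N - xs) / u by rewrite divfK // gt_eqF.
clearbody a b.
have wx : w ^+ 2 = x ^+ 2 - 4 by rewrite -eu /w; field.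
(* The last hypothesis makes a b w^2 at least x^2, whereas w^2 = x^2 - 4. *)
have ab1 : 1 < a * b.
  rewrite -(ltr_pM2r (exprn_gt0 2 w0)) mul1r.
  have -> : a * b * w ^+ 2 = (a * w) * (b * w) by ring.
  have -> : (a * w) * (b * w)
      = x * (y 0%N - xs) * (z 0%N - xs) - (y 0%N - xs) ^+ 2 - (z 0%N - xs) ^+ 2.
    by rewrite aw bw -eu; field.
  have -> : x * (y 0%N - xs) * (z 0%N - xs) - (y 0%N - xs) ^+ 2 - (z 0%N - xs) ^+ 2
      = x * y 0%N * z 0%N - y 0%N ^+ 2 - z 0%N ^+ 2
        - (xs * (x - 2)) * (y 0%N + z 0%N) + xs * (xs * (x - 2)) by ring.
  have cx : 0 <= c * x by rewrite mulr_ge0 //; lra.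
  by rewrite wx exs; have := mulr_ge0 xs0 c0; lra.
have yxs : 0 < y 0%N - xs.
  by rewrite subr_gt0 /xs ltr_pdivrMr ?subr_gt0 // mulrC.
have sumab : a + b = y 0%N - xs.
  by apply: (mulIf (lt0r_neq0 w0)); rewrite mulrDl aw bw /w; field.
(* Both a + b and a b are positive. *)
have a0 : 0 < a.
  rewrite ltNge; apply/negP => a0; have b0 : 0 <= b by lra.
  have := mulr_le0_ge0 a0 b0; lra.
have yE n : y n = xs + a * u ^+ n + b / u ^+ n.
  elim/ltn_ind: n => -[|[|n]] IH.
  - by rewrite expr0 divr1 mulr1; lra.
  - apply: (mulIf (lt0r_neq0 w0)).
    have -> : (xs + a * u ^+ 1 + b / u ^+ 1) * w = xs * w + (a * w) * u + (b * w) / u.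
      by rewrite expr1; field.
    have -> : y 1%N = x * y 0%N - c - z 0%N by lra.
    by rewrite aw bw -exs -eu /w; field.
  have -> : y n.+2 = x * y n.+1 - c - y n by have := ry n; lra.
  rewrite !IH // -exs -eu !exprS; field; rewrite un0 expf_neq0 //.
have zE n : z n = xs + a / u ^+ n.+1 + b * u ^+ n.+1.
  elim/ltn_ind: n => -[|[|n]] IH.
  - apply: (mulIf (lt0r_neq0 w0)).
    have -> : (xs + a / u ^+ 1 + b * u ^+ 1) * w = xs * w + (a * w) / u + (b * w) * u.
      by rewrite expr1; field.
    by rewrite aw bw /w; field.
  - have -> : z 1%N = x * z 0%N - c - y 0%N by lra.
    by rewrite IH // yE -exs -eu !exprS expr0; field.
  have -> : z n.+2 = x * z n.+1 - c - z n by have := rz n; lra.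
  rewrite !IH // -exs -eu !exprS; field; rewrite un0 expf_neq0 //.
(* Hence y n exceeds t + 1/t at t = a u^n, and z n exceeds it at t = u^(n+1) / a. *)
have ba : a^-1 < b by rewrite -(ltr_pM2l a0) divff // gt_eqF.
exists (ln a) => n; split.
- have -> : ln a + n%:R * l = ln (a * u ^+ n).
    by rewrite lnM ?posrE ?exprn_gt0 // lnXn // expRK mulr_natl.
  apply: ln_lt_trace_length => //; first by rewrite mulr_gt0 // exprn_gt0.
  rewrite yE invfM -addrA ltr_wpDl // ltrD2l ltr_pM2r //.
  by rewrite invr_gt0 exprn_gt0.
have -> : n.+1%:R * l - ln a = ln (a^-1 * u ^+ n.+1).
  have av0 : 0 < a^-1 by rewrite invr_gt0.
  have lnVa : ln a^-1 = - ln a by apply: lnV; rewrite posrE.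
  by rewrite lnM ?posrE ?exprn_gt0 // lnVa lnXn // expRK mulr_natl addrC.
apply: ln_lt_trace_length => //; first by rewrite mulr_gt0 ?invr_gt0 // exprn_gt0.
rewrite zE invfM invrK -addrA ltr_wpDl // [X in _ < X]addrC ltrD2r ltr_pM2r //.
by rewrite exprn_gt0.
Qed.
End TraceLength.

Arguments trace_length {R} x.

(** * Supporting functionals of the length *)

Section Supports.
Variables (R : realType) (k : nat).
Local Open Scope ring_scope.
Implicit Types (f h u v x y q : fraction) (g : R * R).

(* In terms of traces the Vieta involution reads X + X' = Y Z - k (k + 2). *)
Definition trace f : R := (3 + 3 * k%:R) * (label k f)%:R - k%:R.

Definition len f : R := trace_length (trace f).

Definition pairing g f : R := g.1 * f.1%:R + g.2 * f.2%:R.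

(** Only the Farey neighbors of [v] are tested; [support_lt] extends the inequality to the other
    fractions. *)
Definition support g v : Prop := pairing g v = len v /\
  forall u, neighbor v u \/ neighbor u v -> pairing g u < len u.

Lemma label_gt0 f : (0 < label k f)%N.
Proof.
rewrite /label /kmarkov_number; case: (f.2 == 0%N) => //; case: eqP => // _.
move: (farey_address _) => w; have := kmarkov_tree_triple k w.
by case: (kmarkov_tree k w) => [[a b] c] [].
Qed.

Lemma trace_ge f : 3 + 2 * k%:R <= trace f.
Proof.
have : 1 <= (label k f)%:R :> R by rewrite ler1n label_gt0.
have := ler0n R k; rewrite /trace; nra.
Qed.

Lemma trace_ge2 f : 2 <= trace f.
Proof. by have := trace_ge f; have := ler0n R k; lra. Qed.

Lemma len_gt0 f : 0 < len f.
Proof.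
by apply: trace_length_gt0; have := trace_ge f; have := ler0n R k; lra.
Qed.

Lemma label_lt f h : len f < len h -> (label k f < label k h)%N.
Proof.
apply: contraTT; rewrite -leqNgt -leNgt => le_hf.
apply: trace_length_le; first exact: trace_ge2.
rewrite /trace lerD2r ler_wpM2l ?ler_nat //.
by have := ler0n R k; lra.
Qed.

Notation c := (k%:R * (k%:R + 2) : R).

(** In traces the Markov equation is this relation with the difference of the two sides equal to (2k
    + 3) k^2. *)
Lemma trace_triple f h : neighbor f h ->
  trace (mediant f h) ^+ 2 + trace f ^+ 2 + trace h ^+ 2
    + c * (trace (mediant f h) + trace f + trace h)
  <= trace (mediant f h) * trace f * trace h.
Proof.
case/(label_triple k) => _ _ _ /(congr1 (fun n : nat => n%:R : R)).
rewrite !(natrD, natrM, natrX) /trace; have k0 := ler0n R k.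
set X := (label k f)%:R; set Y := (label k _)%:R; set Z := (label k h)%:R => e.
rewrite -subr_ge0.
set T := (X in 0 <= X).
have -> : T = (2 * k%:R + 3) * k%:R ^+ 2 + (3 + 3 * k%:R) ^+ 2 *
   ((3 + 3 * k%:R) * X * Y * Z
     - (X ^+ 2 + Y ^+ 2 + Z ^+ 2 + k%:R * (X * Y + X * Z + Y * Z))).
  by rewrite /T; ring.
by rewrite e subrr mulr0 addr0 mulr_ge0 ?exprn_ge0 //; lra.
Qed.

Lemma trace_vieta_left f h : neighbor f h ->
  trace (mediant (mediant f h) h) + trace f = trace h * trace (mediant f h) - c.
Proof.
move/(label_vieta_left k)/(congr1 (fun n : nat => n%:R : R)).
rewrite !(natrD, natrM) /trace.
set X := (label k f)%:R; set Y := (label k (mediant f h))%:R.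
set Z := (label k h)%:R; set T := (label k _)%:R => e.
have -> : T = (3 + 3 * k%:R) * Y * Z - k%:R * (Y + Z) - X by lra.
by ring.
Qed.

Lemma trace_vieta_right f h : neighbor f h ->
  trace (mediant f (mediant f h)) + trace h = trace f * trace (mediant f h) - c.
Proof.
move/(label_vieta_right k)/(congr1 (fun n : nat => n%:R : R)).
rewrite !(natrD, natrM) /trace.
set X := (label k h)%:R; set Y := (label k (mediant f h))%:R.
set Z := (label k f)%:R; set T := (label k _)%:R => e.
have -> : T = (3 + 3 * k%:R) * Z * Y - k%:R * (Z + Y) - X by lra.
by ring.
Qed.

Lemma trace_shift_right v h n : neighbor v h ->
  trace (shift h v n.+2) + trace (shift h v n) = trace v * trace (shift h v n.+1) - c.
Proof.
move=> nb; have [nbn _] := neighbor_shift _ _ n nb.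
have eS m : shift h v m.+1 = mediant v (shift h v m).
  by rewrite /shift /mediant /=; congr (_, _); lia.
by rewrite !eS trace_vieta_right.
Qed.

Lemma trace_shift_left f v n : neighbor f v ->
  trace (shift f v n.+2) + trace (shift f v n) = trace v * trace (shift f v n.+1) - c.
Proof.
move=> nb; have [_ nbn] := neighbor_shift _ _ n nb.
have eS m : shift f v m.+1 = mediant (shift f v m) v.
  by rewrite /shift /mediant /=; congr (_, _); lia.
by rewrite !eS trace_vieta_left.
Qed.

Lemma shift0 f v : shift f v 0 = f.
Proof. by case: f => a b; rewrite /shift /= !mul0n !addn0. Qed.

(** Puts the constant solution of the recurrence below the initial value, as [support_of_recurrence]
    requires. *)
Lemma trace_constant_lt x y : c < (trace x - 2) * trace y.
Proof.
have := trace_ge x; have := trace_ge y; have := ler0n R k.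
move: (trace x) (trace y) => X Y k0 hY hX.
have : (1 + 2 * k%:R) * (3 + 2 * k%:R) <= (X - 2) * Y by rewrite ler_pM //; lra.
by nra.
Qed.

Lemma support_mediant f h : neighbor f h -> exists g, support g (mediant f h).
Proof.
move=> nb; have [nbl nbr] := neighbor_mediant _ _ nb.
set v := mediant f h in nbl nbr *; have k0 := ler0n R k.
have eh1 : shift h v 1 = mediant v h by rewrite /shift /mediant /=; congr (_, _); lia.
have ef1 : shift f v 1 = mediant f v by rewrite /shift /mediant /=; congr (_, _); lia.
have [||||||||||s Hs] := @support_of_recurrence R (trace v) c
  (fun n => trace (shift h v n)) (fun n => trace (shift f v n)).
- by have := trace_ge v; lra.
- by rewrite mulr_ge0 ?addr_ge0.
- exact: trace_constant_lt.
- by move=> n; exact: trace_ge2.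
- by move=> n; exact: trace_ge2.
- by move=> n; exact: trace_shift_right.
- by move=> n; exact: trace_shift_left.
- by rewrite !shift0 eh1 trace_vieta_left // mulrC.
- by rewrite !shift0 ef1 trace_vieta_right // mulrC.
- rewrite !shift0; have := trace_triple _ _ nb; rewrite -/v; lra.
have det : f.2%:R * h.1%:R - f.1%:R * h.2%:R = 1 :> R.
  by rewrite -!natrM nb -natr1 addrC addKr.
(* The functional with values [s] at [h] and [len v - s] at [f], hence [len v] at [v]; on h + n v
   and f + n v it takes the two bounds in [Hs]. *)
pose g : R * R := (f.2%:R * s - h.2%:R * (len v - s), h.1%:R * (len v - s) - f.1%:R * s).
have gh : pairing g h = s.
  by rewrite -[RHS]mulr1 -det /pairing /g /=; ring.
have gf : pairing g f = len v - s.
  by rewrite -[RHS]mulr1 -det /pairing /g /=; ring.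
have gv : pairing g v = len v.
  have -> : pairing g v = pairing g f + pairing g h.
    by rewrite /pairing /v /= !natrD; ring.
  by rewrite gf gh subrK.
have gS u n : pairing g (shift u v n) = pairing g u + n%:R * len v.
  by rewrite -gv /pairing /shift /= !natrD !natrM; ring.
exists g; split=> // u nu.
have [Pr Pl] := neighbor_of_mediantP f h u nb.
case: nu => [/Pr|/Pl] [n ->]; rewrite gS.
  by rewrite gh; case: (Hs n).
rewrite gf; case: (Hs n) => _; rewrite /len -natr1; lra.
Qed.

(* Reflecting the support [(s, l)] at 0/1 gives the support [(l - s, l)], and
   one of [s] and [l - s] is nonnegative. *)
Lemma support_zero : exists g, support g (0, 1)%N /\ 0 <= g.1.
Proof.
set v : fraction := (0, 1)%N; pose h : fraction := (1, 0)%N.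
have nb : neighbor v h by [].
have k0 := ler0n R k; have l0 := len_gt0 v.
have tv : trace v = 3 + 2 * k%:R by rewrite /trace /label /= [kmarkov_number _ _](kmarkov_number0 k); ring.
have th : trace h = 3 + 2 * k%:R by rewrite /trace /label /=; ring.
have t1 : trace (shift h v 1) = (3 + 3 * k%:R) * (k%:R + 2) - k%:R.
  have -> : shift h v 1 = (1, 1)%N by [].
  by rewrite /trace /label /= [kmarkov_number _ _](kmarkov_number1 k) -[in LHS](addn2 k) (natrD _ k).
pose y n := trace (shift h v n).
have rec n : y n.+2 + y n = trace v * y n.+1 - c by exact: trace_shift_right.
have e1 : y 1%N + y 0%N = trace v * y 0%N - c by rewrite /y shift0 t1 tv th; ring.
(* One sequence serves as both [y] and [z]: since (1, 1, 1) is a k-Markov triple, the sequence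
   continued to index -1 repeats its value at 0. *)
have [||||||s Hs] := @support_of_recurrence R (trace v) c y y _ _ _ _ _ rec rec e1 e1.
- by rewrite tv; lra.
- by rewrite mulr_ge0 ?addr_ge0.
- exact: trace_constant_lt.
- by move=> n; exact: trace_ge2.
- by move=> n; exact: trace_ge2.
- rewrite /y shift0 th tv -subr_ge0; set T := (X in 0 <= X).
  have -> : T = (2 * k%:R + 3) * k%:R ^+ 2 by rewrite /T; ring.
  by rewrite mulr_ge0 ?exprn_ge0 //; lra.
have sup r : (forall n, r + n%:R * len v < len (shift h v n)) -> support (r, len v) v.
  move=> Hr; split; first by rewrite /pairing /= mulr0 add0r mulr1.
  case=> a b [] ea; last by move: ea; rewrite /neighbor /= muln0.
  have -> : a = 1%N by move: ea; rewrite /neighbor /= mul1n mul0n.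
  have := Hr b; have -> : shift h v b = (1, b)%N.
    by rewrite /shift /h /v /= muln0 muln1.
  by rewrite /pairing /= mulr1 mulrC.
have [s0|s0] := leP 0 s.
  by exists (s, len v); split=> //; apply: sup => n; case: (Hs n).
exists (len v - s, len v); split; last by rewrite /=; lra.
by apply: sup => n; case: (Hs n) => _; rewrite -/(len v) -natr1 /y -/(len _); lra.
Qed.

Lemma support_exists v : (0 < v.2)%N -> coprime v.1 v.2 -> exists g, support g v.
Proof.
case: v => [[|a] b] /= b0 co.
  move: co; rewrite /coprime gcd0n => /eqP ->.
  by have [g [sg _]] := support_zero; exists g.
have [w] := coprime_middle a.+1 b erefl b0 co.
have [f [h [-> nb]]] := farey_treeE w; rewrite /middle /= => <-.
exact: support_mediant.
Qed.

(* q lies between x and y: g <= g' at q and g >= g' at x, hence g <= g' at y. *)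
Lemma support_crossing g g' x q y (d e : nat) : (0 < d)%N ->
  (d * q.1 = e * x.1 + y.1)%N -> (d * q.2 = e * x.2 + y.2)%N ->
  support g x -> pairing g q <= len q -> support g' q -> pairing g' x <= len x ->
  pairing g' y < len y -> pairing g y < len y.
Proof.
move=> d0 e1 e2 [gx _] gq [g'q _] g'x; apply: le_lt_trans.
have P r : pairing r y = d%:R * pairing r q - e%:R * pairing r x.
  have /(congr1 (fun n : nat => n%:R : R)) := e1; rewrite natrD !natrM => e1'.
  have /(congr1 (fun n : nat => n%:R : R)) := e2; rewrite natrD !natrM => e2'.
  have -> : pairing r y = r.1 * (d%:R * q.1%:R - e%:R * x.1%:R)
      + r.2 * (d%:R * q.2%:R - e%:R * x.2%:R).
    by rewrite e1' e2' /pairing; ring.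
  by rewrite /pairing; ring.
rewrite !P gx g'q lerB // ler_wpM2l //.
Qed.

Lemma support_lt g x y : (0 < x.2)%N -> (0 < y.2)%N ->
  coprime x.1 x.2 -> coprime y.1 y.2 -> x != y ->
  support g x -> pairing g y < len y.
Proof.
pose dist x y := ((x.2 * y.1 - x.1 * y.2) + (x.1 * y.2 - x.2 * y.1))%N.
have [n] := ubnP (dist x y); elim: n x g => // n IH x g.
rewrite /dist => lt_n x0 y0 cx cy nxy gx.
(* Induction step through a neighbor [q] of [x] between [x] and [y], with smaller determinant
   against [y]. *)
have step q d e : neighbor x q \/ neighbor q x -> (0 < q.2)%N -> (0 < e < d)%N ->
    (d * q.1 = e * x.1 + y.1)%N -> (d * q.2 = e * x.2 + y.2)%N ->
    (dist q y < n)%N -> q != y -> pairing g y < len y.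
  move=> nb q0 /andP[e0 ed] e1 e2 dn nqy.
  have cq : coprime q.1 q.2 by case: nb => /coprime_neighbor[].
  have [g' gq] := support_exists q q0 cq.
  apply: (@support_crossing g g' x q y d e) => //; first exact: leq_trans ed.
  - by apply: ltW; apply: gx.2.
  - by apply: ltW; apply: gq.2; case: nb; [right | left].
  - exact: (IH q g').
case: (ltngtP (x.2 * y.1) (x.1 * y.2)) => [lt|gt|eq].
- have [e|ne] := eqVneq (x.2 * y.1 + 1)%N (x.1 * y.2)%N.
    by apply: gx.2; right; rewrite /neighbor; lia.
  (* Inverting both fractions reverses their order, so the lemma applies to [swap x] and
     [swap y]. *)
  have [||| q [d [e [[ed exy eqy] [nb e2 e1]]]]] := fraction_between (swap x) (swap y).
  + by rewrite coprime_sym.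
  + by rewrite coprime_sym.
  + by rewrite /=; lia.
  rewrite /= in exy eqy e1 e2.
  apply: (step (swap q) d e) => //.
  + by right; move: nb; rewrite /neighbor /=; lia.
  + by move: nb; rewrite /neighbor /=; case: q.1 => //; rewrite muln0.
  + by rewrite /dist /=; lia.
  + by apply/eqP => eqqy; move: eqy; rewrite -eqqy /=; lia.
- have [e|ne] := eqVneq (x.1 * y.2 + 1)%N (x.2 * y.1)%N.
    by apply: gx.2; left; rewrite /neighbor; lia.
  have [||| q [d [e [[ed exy eqy] [nb e1 e2]]]]] := fraction_between x y => //.
  + by lia.
  apply: (step q d e) => //.
  + by left.
  + by case: q.2 e2 => //; rewrite muln0; lia.
  + by rewrite /dist; lia.
  + by apply/eqP => eqqy; move: eqy; rewrite -eqqy /=; lia.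
case/eqP: nxy; apply: rat_of_fraction_inj => //; apply/eqP.
by rewrite eqr_div ?pnatr_eq0 -?lt0n // -!natrM eqr_nat -eq mulnC.
Qed.
End Supports.

(** * Monotonicity in the three directions *)

Theorem theorem4 (k p q : nat) :
  1 <= p -> p < q -> gcdn p q = 1 ->
  [/\ forall q' : nat, q < q' -> gcdn p q' = 1 ->
        kmarkov_number k (p%:Q / q%:Q)%R < kmarkov_number k (p%:Q / q'%:Q)%R,
      forall p' : nat, p < p' -> p' < q -> gcdn p' q = 1 ->
        kmarkov_number k (p%:Q / q%:Q)%R < kmarkov_number k (p'%:Q / q%:Q)%R
    & forall i : nat, 0 < i -> i < p -> gcdn (p - i) (q + i) = 1 ->
        kmarkov_number k (p%:Q / q%:Q)%R
          < kmarkov_number k ((p - i)%N%:Q / (q + i)%N%:Q)%R].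
Proof.
move=> p0 pq /eqP co; pose R : realType := Rdefinitions.R; pose v : fraction := (p, q).
have q0 : 0 < q by lia.
have [g [gv gN]] : exists g, support R k g v by exact: support_exists.
have glt a b : 0 < b -> coprime a b -> v <> (a, b) ->
    (pairing R g (a, b) < len R k (a, b))%R.
  by move=> b0 cab /eqP ne; apply: (support_lt R k g v (a, b)).
have increase a b : 0 < b -> coprime a b -> v <> (a, b) ->
    (pairing R g v <= pairing R g (a, b))%R ->
    kmarkov_number k (p%:Q / q%:Q)%R < kmarkov_number k (a%:Q / b%:Q)%R.
  move=> b0 cab ne le_g.
  have lab (r s : nat) : 0 < s -> kmarkov_number k (r%:Q / s%:Q)%R = label k (r, s).
    by rewrite /label /=; case: s.
  rewrite !lab //; apply: (label_lt R); rewrite -gv.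
  exact: le_lt_trans (glt a b b0 cab ne).
have cqp : coprime q p by rewrite coprime_sym.
have pqR : (0 < q%:R - p%:R :> R)%R by rewrite subr_gt0 ltr_nat.
have p0R : (0 < p%:R :> R)%R by rewrite ltr0n.
have lv0 := len_gt0 R k v.
have g12 : (g.1 < g.2)%R.
  have := glt q p p0 cqp; have ne : v <> (q, p) by case; lia.
  move=> /(_ ne).
  have -> : len R k (q, p) = len R k v by rewrite /len /trace -(label_swap k v).
  rewrite -gv /pairing /= => lt.
  (* The inequality p g1 + q g2 > q g1 + p g2 is (g2 - g1)(q - p) > 0. *)
  rewrite -subr_gt0 -(pmulr_lgt0 _ pqR); lra.
have g2 : (0 < g.2)%R.
  rewrite ltNge; apply/negP => g2; move: lv0; rewrite -gv /pairing /=.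
  by nra.
have g1 : (0 <= g.1)%R.
  have g2le : (g.2 < len R k (0, 1))%R.
    have ne : v <> (0, 1) by case; lia.
    have := glt 0 1 erefl erefl ne.
    by rewrite /pairing /= mulr0 add0r mulr1.
  (* As h1 >= 0 and h2 = L(0/1), q L(0/1) <= h(v) < L(v) = p g1 + q g2, while g2 < L(0/1); so p g1 >
     0. *)
  have [h [h0 h1]] := support_zero R k.
  have : (pairing R h v < len R k v)%R.
    by apply: (support_lt R k h (0, 1) v) => //; apply/eqP => -[]; lia.
  have := h0.1; rewrite /pairing /= mulr0 add0r mulr1 -gv /pairing /= => ->.
  nra.
(* From v to v' the functional grows by (q' - q) g2, (p' - p) g1 and i (g2 - g1) respectively. *)
split=> [q' qq' /eqP co' | p' pp' p'q /eqP co' | i i0 ip /eqP co'].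
- apply: increase => //; [lia | by case; lia |].
  by rewrite /pairing /= lerD2l ler_wpM2l ?ler_nat ?(ltW g2) // ltnW.
- apply: increase => //; first by case; lia.
  by rewrite /pairing /= lerD2r ler_wpM2l ?ler_nat // ltnW.
apply: increase => //; [lia | by case; lia |].
rewrite /pairing /= natrB ?natrD; last exact: ltnW.
have : (0 < i%:R :> R)%R by rewrite ltr0n.
nra.
Qed.
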